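(* Let $\mathfrak{F}=\langle W,R\rangle$ be a bounded graph. Then for every $n\in\omega$ and every non-principal ultrafilter $u$ over $W$, \[\{w\in W:\langle w\rangle^n\cong\langle u\rangle^n\}\in u,\] where $\langle w\rangle^n$ is the $n$-Hull of $w$ in $\mathfrak{F}$ and $\langle u\rangle^n$ is the $n$-Hull of $u$ in $\mathfrak{F}^{\mathfrak{ue}}$.
   Context: A directed graph $\mathfrak{F}=\langle W,R\rangle$ is bounded if there is $m\in\omega$ with $|\{s:Rws\}|+|\{s:Rsw\}|\leq m$ for all $w\in W$. For $X\subseteq W$, $R^-(X)=\{w:\exists s\,(Rws\wedge s\in X)\}$, $R^+(X)=\{s:\exists w\,(Rws\wedge w\in X)\}$, $R(X)=R^-(X)\cup R^+(X)$. The ultrafilter extension is $\mathfrak{F}^{\mathfrak{ue}}=\langle\mathrm{Uf}(W),R^{\mathfrak{ue}}\rangle$, with $\mathrm{Uf}(W)$ the set of ultrafilters over $W$ and $R^{\mathfrak{ue}}uv$ iff $R^-(X)\in u$ for every $X\in v$. In any directed graph $\langle V,S\rangle$ and $x\in V$, define $\langle x\rangle^0=\{x\}$ and $\langle x\rangle^{i+1}=S(\langle x\rangle^i)\cup\langle x\rangle^i$ (with $S(\cdot)$ defined as $R(\cdot)$ above); the $n$-Hull of $x$ is the induced substructure $\langle\langle x\rangle^n,S\restriction\langle x\rangle^n\rangle$. For $x$ in one graph and $y$ in another, $\langle x\rangle^n\cong\langle y\rangle^n$ means there is an isomorphism between the $n$-Hulls sending $x$ to $y$. *)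

(* Defs.v *)
From mathcomp Require Import all_boot.
From mathcomp Require Import boolp classical_sets functions cardinality filter.

Set Implicit Arguments.
Unset Strict Implicit.
Unset Printing Implicit Defensive.

Local Open Scope classical_set_scope.
Local Open Scope card_scope.

Record digraph := Digraph {
  vertex :> Type;
  edge : vertex -> vertex -> Prop
}.
Arguments edge : clear implicits.

(* R^-(X), R^+(X) and R(X) *)
Definition pre (G : digraph) (X : set G) : set G :=
  [set w | exists s, edge G w s /\ X s].

Definition post (G : digraph) (X : set G) : set G :=
  [set s | exists w, edge G w s /\ X w].

Definition nbr (G : digraph) (X : set G) : set G := pre X `|` post X.

(* `A #= `I_a` says that A is finite with exactly a elements, so that a + b
   below is out-degree plus in-degree (a loop is counted twice). *)
Definition bounded_digraph (G : digraph) : Prop :=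
  exists m : nat, forall w : G, exists a b : nat,
    [/\ [set s | edge G w s] #= `I_a,
        [set s | edge G s w] #= `I_b
      & a + b <= m].

Definition Uf (W : Type) : Type := {u : set_system W | UltraFilter u}.

Definition nonprincipal (W : Type) (u : Uf W) : Prop :=
  ~ exists w : W, sval u = principal_filter w.

Definition ue (G : digraph) : digraph :=
  {| vertex := Uf G;
     edge := fun u v => forall X : set G, sval v X -> sval u (pre X) |}.

(* The set <x>^n. *)
Fixpoint hull_set (G : digraph) (x : G) (n : nat) : set G :=
  if n is i.+1 then nbr (hull_set x i) `|` hull_set x i else [set x].

Lemma hull_set_center (G : digraph) (x : G) (n : nat) : hull_set x n x.
Proof. by elim: n => [|n IHn] //=; right. Qed.

Definition induced (G : digraph) (A : set G) : digraph :=
  {| vertex := {y : G | A y};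
     edge := fun a b => edge G (sval a) (sval b) |}.

Definition hull (G : digraph) (n : nat) (x : G) : digraph := induced (hull_set x n).

Definition hull_root (G : digraph) (n : nat) (x : G) : hull n x :=
  exist (hull_set x n) x (hull_set_center x n).

Definition is_isomorphism (G H : digraph) (f : G -> H) : Prop :=
  bijective f /\ forall a b : G, edge G a b <-> edge H (f a) (f b).

(* <x>^n \cong <y>^n *)
Definition hull_iso (G H : digraph) (n : nat) (x : G) (y : H) : Prop :=
  exists f : hull n x -> hull n y,
    is_isomorphism f /\ f (hull_root n x) = hull_root n y.
Arguments hull_iso : clear implicits.

(* Main.v *)
Require Import Defs.
From mathcomp Require Import all_boot.
From mathcomp Require Import boolp classical_sets functions cardinality filter.

Set Implicit Arguments.
Unset Strict Implicit.
Unset Printing Implicit Defensive.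

Local Open Scope classical_set_scope.

(** Boundedness gives finitely many maps [f_i : W -> W] such that the vertices
    equal or adjacent to [x] are exactly the [f_i x].  Pushing ultrafilters
    forward, the vertices of the ultrafilter extension equal or adjacent to [v]
    are exactly the [f_i v].  Hence both n-hulls consist of the values of the
    words [s] of length [n] in the [f_i], at [w] and at [u] respectively, and it
    suffices that for [u]-almost all [w] the map [s w |-> s u] respects and
    reflects equality and edges.  The key point is that [s u = t u] implies
    [s w = t w] for [u]-almost all [w]: since [s w] and [t w] are at bounded
    distance and balls are uniformly finite, some set in [s u] has no two
    distinct points that are this close; both [s w] and [t w] lie in it for
    [u]-almost all [w]. *)

(** * Ultrafilters and their images under maps *)

Lemma ultra_setC (T : Type) (F : set_system T) (A : set T) :
  UltraFilter F -> ~ F A -> F (~` A).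
Proof. by move=> FU nA; have [] := in_ultra_setVsetC A FU. Qed.

Lemma ultra_nsetC (T : Type) (F : set_system T) (A : set T) :
  UltraFilter F -> F A -> F (~` A) -> False.
Proof.
move=> FU FA FC; have FP := @ultra_proper _ _ FU.
by apply: (@filter_not_empty _ F); rewrite -(setICr A); apply: filterI.
Qed.

(** Finiteness of [I] is essential: if no [P i] were in [F], the finite intersection of their
    complements would be in [F], yet it misses [D]. *)
Lemma ultra_cover (T : Type) (F : set_system T) (I : finType) (D : set T)
    (P : I -> set T) :
  UltraFilter F -> F D -> (forall x, D x -> exists i, P i x) ->
  exists i, F (P i).
Proof.
move=> FU FD cov; apply: contrapT => /forallNP nP.
have FP := @ultra_proper _ _ FU.
apply: (ultra_nsetC FU FD).
have : F [set x | forall i, ~ P i x].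
  by apply: filter_forall => i; apply: ultra_setC.
by apply: filterS => x nPx /cov [i /nPx].
Qed.

Lemma ultra_setVsetC (T : Type) (F : set_system T) :
  ProperFilter F -> (forall A, F A \/ F (~` A)) -> UltraFilter F.
Proof.
move=> FP dec; split=> // G GP FG; apply/seteqP; split=> // A GA.
have [//|/FG GC] := dec A.
by exfalso; apply: (@filter_not_empty _ G); rewrite -(setICr A); apply: filterI.
Qed.

Lemma fmap_ultra (T U : Type) (f : T -> U) (F : set_system T) :
  UltraFilter F -> UltraFilter (fmap f F).
Proof.
move=> FU; have FP := @ultra_proper _ _ FU.
by apply: ultra_setVsetC => A; apply: (in_ultra_setVsetC (f @^-1` A)).
Qed.

Definition push (W V : Type) (f : W -> V) (u : Uf W) : Uf V :=
  exist _ (fmap f (sval u)) (fmap_ultra f (svalP u)).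

Lemma Uf_eqP (W : Type) (u v : Uf W) : sval u `<=` sval v -> u = v.
Proof.
case: u v => [u uU] [v vU] /= uv; apply: eq_exist.
by rewrite (max_filter (@ultra_proper _ _ vU) uv).
Qed.

Lemma push_id (W : Type) (u : Uf W) : push id u = u.
Proof. exact: Uf_eqP. Qed.

Lemma push_comp (W V U : Type) (f : V -> U) (g : W -> V) (u : Uf W) :
  push f (push g u) = push (f \o g) u.
Proof. exact: Uf_eqP. Qed.

Lemma push_near_eq (W V : Type) (f g : W -> V) (u : Uf W) :
  sval u [set w | f w = g w] -> push f u = push g u.
Proof.
have uP := @ultra_proper _ _ (svalP u).
move=> fg; apply: Uf_eqP => X /= uX; rewrite /fmap /=.
by apply: filterS2 fg uX => w /= ->.
Qed.

(** * Independent sets belonging to an ultrafilter *)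

Definition independent (W : Type) (E : W -> W -> Prop) (A : set W) :=
  forall x y, A x -> A y -> ~ E x y.

(** Zorn's lemma applies because a union of a chain of independent sets is independent. A point of
    [D] outside a maximal [A] and unrelated to [A] could be added to it. *)
Lemma ex_maximal_independent (W : Type) (E : W -> W -> Prop) (D : set W) :
  (forall x, ~ E x x) -> (forall x y, E x y -> E y x) ->
  exists A, [/\ A `<=` D, independent E A &
    forall x, D x -> ~ A x -> exists2 y, A y & E x y].
Proof.
move=> Eirr Esym.
have [|A [[AD Aind] Amax]] := @Zorn_bigcup W
    [set A | A `<=` D /\ independent E A].
  move=> C CP Ctot; split=> [x [X CX Xx]|x y [X CX Xx] [Y CY Yy]].
    exact: (CP _ CX).1 Xx.
  have [XY|YX] := Ctot _ _ CX CY.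
    exact: (CP _ CY).2 (XY _ Xx) Yy.
  exact: (CP _ CX).2 Xx (YX _ Yy).
exists A; split=> // x Dx nAx; apply: contrapT => nE.
have {}nE y : A y -> ~ E x y by move=> Ay Exy; apply: nE; exists y.
apply: (Amax (A `|` [set x])).
  by split=> [|H]; [exact: subsetUl|apply: nAx; apply: H; right].
split; first by move=> y [/AD|->].
move=> y z [Ay|->] [Az|->].
- exact: Aind.
- by move=> /Esym; apply: nE.
- exact: nE.
- exact: Eirr.
Qed.

(* Induction on the number of maps [q i] needed to reach all neighbours: if a
   maximal independent set [A] is not in [v], then for some [i] almost all [x]
   satisfy [A (q i x)], so that [q i] may be dropped outside of [A]. *)
Lemma ultra_independent (W : Type) (v : Uf W) (E : W -> W -> Prop)
    (I : finType) (q : I -> W -> W) :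
  (forall x, ~ E x x) -> (forall x y, E x y -> E y x) ->
  (forall x y, E x y -> exists i, y = q i x) ->
  exists2 A, sval v A & independent E A.
Proof.
move=> Eirr Esym Eq; have vU := svalP v; have vP := @ultra_proper _ _ vU.
suff H k : forall (J : {set I}) (D : set W), #|J| <= k -> sval v D ->
    (forall x y, D x -> D y -> E x y -> exists2 i, i \in J & y = q i x) ->
    exists2 A, sval v A & independent E A.
  apply: (H #|[set: I]%SET| [set: I]%SET setT) => //; first exact: filterT.
  by move=> x y _ _ /Eq [i ->]; exists i; rewrite ?inE.
elim: k => [|k IHk] J D Jk vD Jcov.
  exists D => // x y Dx Dy /(Jcov _ _ Dx Dy) [i].
  by move: Jk; rewrite leqn0 cards_eq0 => /eqP ->; rewrite inE.
have [A [AD Aind Amax]] := ex_maximal_independent D Eirr Esym.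
have [|/(ultra_setC vU) vA] := pselect (sval v A); first by exists A.
have vDA : sval v (D `&` ~` A) by apply: filterI.
have [|i vi] := @ultra_cover _ _ I _
    (fun i x => [/\ i \in J, D x, ~ A x & A (q i x)]) vU vDA.
  move=> x [Dx nAx]; have [y Ay Exy] := Amax x Dx nAx.
  by have [i iJ yE] := Jcov _ _ Dx (AD _ Ay) Exy; exists i; split; rewrite -?yE.
have [_ [iJ _ _ _]] := filter_ex vi.
apply: (IHk (J :\ i)%SET _ _ vi) => [|x y [_ Dx _ Ax] [_ Dy nAy _] Exy].
  by move: Jk; rewrite (cardsD1 i) iJ.
have [j jJ yE] := Jcov _ _ Dx Dy Exy; exists j => //.
by rewrite !inE jJ andbT; apply/eqP => ji; apply: nAy; rewrite yE ji.
Qed.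

(** * Enumerated neighbours and words acting on vertices *)

Definition adj (G : digraph) (x y : G) : Prop :=
  x = y \/ (edge G x y \/ edge G y x).

Lemma adj_sym (G : digraph) (x y : G) : adj x y -> adj y x.
Proof. by move=> [->|[]]; [left|right; right|right; left]. Qed.

(** Reflexivity of [adj] absorbs the union with the previous stage, so words of length exactly [n]
    will reach the whole hull. *)
Lemma hull_setS (G : digraph) (x y : G) (n : nat) :
  hull_set x n.+1 y <-> exists2 z, hull_set x n z & adj z y.
Proof.
split=> [[[[z [e h]]|[z [e h]]]|h]|[z h [<-|[e|e]]]] /=.
- by exists z => //; right; right.
- by exists z => //; right; left.
- by exists y => //; left.
- by right.
- by left; right; exists z.
- by left; left; exists z.
Qed.

Definition adj_enum (G : digraph) (I : Type) (f : I -> G -> G) :=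
  forall x y, adj x y <-> exists i, y = f i x.

(** The default [x0] fills the slots that name no element of [A], so that the index type ['I_m] can
    be the same at all vertices. *)
Lemma card_enum (W : Type) (A : set W) (a m : nat) (x0 : W) :
  (A #= `I_a)%card -> a <= m ->
  exists c : 'I_m -> W, (forall i, A (c i) \/ c i = x0) /\
    forall y, A y -> exists i, y = c i.
Proof.
move=> /card_set_bijP [f [fA finj _]] am.
have /choice [c cP] (i : 'I_m) : exists z, (A z /\ f z = i) \/
    (z = x0 /\ forall y, A y -> f y <> i).
  have [[z zP]|nz] := pselect (exists z, A z /\ f z = i); first by exists z; left.
  by exists x0; right; split=> // y Ay fy; apply: nz; exists y.
exists c; split=> [i|y Ay]; first by have [[]|[]] := cP i; [left|right].
have fym : f y < m by apply: leq_trans am; apply: (fA y Ay).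
exists (Ordinal fym); have [[Ac fc]|[_ /(_ _ Ay)]] := cP (Ordinal fym); last by [].
by apply: finj; rewrite ?inE.
Qed.

Lemma bounded_adj_enum (G : digraph) : bounded_digraph G ->
  exists (I : finType) (f : I -> G -> G), adj_enum f.
Proof.
move=> [m Gm]; exists (option ('I_m + 'I_m)%type).
have /choice [f fP] (x : G) : exists c : option ('I_m + 'I_m)%type -> G,
    forall y, adj x y <-> exists i, y = c i.
  have [a [b [ca cb abm]]] := Gm x.
  have [c [c1 c2]] := card_enum x ca (leq_trans (leq_addr _ _) abm).
  have [d [d1 d2]] := card_enum x cb (leq_trans (leq_addl _ _) abm).
  (* Left indices list out-neighbours and right ones in-neighbours, both padded with [x], which is
     adjacent to itself. *)
  exists (fun i => match i with
    | Some (inl i) => c i | Some (inr i) => d i | None => x end) => y; split.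
    move=> [<-|[/c2 [i ->]|/d2 [i ->]]].
    - by exists None.
    - by exists (Some (inl i)).
    - by exists (Some (inr i)).
  move=> [[[i|i]|] ->]; last by left.
    by have [?|->] := c1 i; [right; left|left].
  by have [?|->] := d1 i; [right; right|left].
by exists (fun i x => f x i).
Qed.

Definition word_act (W I : Type) (f : I -> W -> W) (s : seq I) (x : W) : W :=
  foldr f x s.

(** Adjacency is symmetric, so a walk can be retraced step by step. The letter undoing a step varies
    with the vertex, hence [r] depends on [x]. *)
Lemma word_act_inv (G : digraph) (I : Type) (f : I -> G -> G) (s : seq I)
    (x : G) : adj_enum f ->
  exists2 r, size r = size s & x = word_act f r (word_act f s x).
Proof.
move=> fP; elim: s => [|i s [r rs rE]] /=; first by exists [::].
have /adj_sym/fP [j jE] : adj (word_act f s x) (f i (word_act f s x)).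
  by apply/fP; exists i.
exists (rcons r j); first by rewrite size_rcons rs.
by rewrite /word_act foldr_rcons -jE.
Qed.

Lemma hull_set_word (G : digraph) (I : Type) (f : I -> G -> G) (n : nat)
    (x y : G) : adj_enum f ->
  hull_set x n y <-> exists s : n.-tuple I, y = word_act f s x.
Proof.
move=> fP; elim: n y => [|n IHn] y.
  by split=> [->|[s ->]]; [exists [tuple]|rewrite (tuple0 s)].
rewrite hull_setS; split=> [[z /IHn [s ->] /fP [i ->]]|[s ->]].
  by exists [tuple of i :: s].
exists (word_act f (behead_tuple s) x); first by apply/IHn; exists (behead_tuple s).
by rewrite (tuple_eta s); apply/fP; exists (thead s).
Qed.

Lemma push_word_inj (G : digraph) (I : finType) (f : I -> G -> G)
    (u : Uf G) (s t : seq I) : adj_enum f ->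
  push (word_act f s) u = push (word_act f t) u ->
  sval u [set w | word_act f s w = word_act f t w].
Proof.
move=> fP st; have uP := @ultra_proper _ _ (svalP u).
(* Room for a walk from [word_act f s w] back to [w] and on to [word_act f t w]. *)
pose k := size t + size s.
pose E (x y : G) := x <> y /\ exists r : k.-tuple I, y = word_act f r x.
have [|||A sA Aind] := @ultra_independent _ (push (word_act f s) u) E
    (k.-tuple I) (fun r => word_act f r).
- by move=> x [].
- move=> x y [xy [r yE]]; split; first exact: nesym.
  have [r' r's xE] := word_act_inv r x fP.
  have r'k : size r' == k by rewrite r's size_tuple.
  by exists (Tuple r'k); rewrite yE.
- by move=> x y [].
have tA : sval (push (word_act f t) u) A by rewrite -st.
have {}sA : sval u (word_act f s @^-1` A) by [].
have {}tA : sval u (word_act f t @^-1` A) by [].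
apply: filterS2 sA tA => w /= As At; apply: contrapT => ne.
apply: (Aind _ _ As At); split=> //.
have [r rs rE] := word_act_inv s w fP.
have tk : size (t ++ r) == k by rewrite size_cat rs.
exists (Tuple tk); rewrite /= /word_act foldr_cat.
by rewrite -/(word_act f s w) -/(word_act f r _) -rE.
Qed.

(** * Edges of the ultrafilter extension *)

Lemma ue_edge_push (G : digraph) (W : Type) (s t : W -> G) (u : Uf W) :
  sval u [set w | edge G (s w) (t w)] -> edge (ue G) (push s u) (push t u).
Proof.
have uP := @ultra_proper _ _ (svalP u).
move=> st X tX; apply: filterS2 st tX => w /= e Xt.
by exists (t w).
Qed.

Lemma ue_edge_post (G : digraph) (u v : Uf G) (X : set G) :
  edge (ue G) u v -> sval u X -> sval v (post X).
Proof.
move=> uv uX; have uP := @ultra_proper _ _ (svalP u).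
apply: contrapT => /(ultra_setC (svalP v)) /uv upre.
apply: (@filter_not_empty _ (sval u)); apply: filterS2 uX upre => w Xw [s [e ns]].
by apply: ns; exists w.
Qed.

(** If every [i] failed, each would have a witness [X i] in [v]. The finite intersection of the
    [X i] is still in [v], and pulling it back along [S] lets [ultra_cover] pick an [i] that
    contradicts its own witness. *)
Lemma ultra_select (W : Type) (I : finType) (f : I -> W -> W)
    (S : W -> W -> Prop) (u v : Uf W) :
  (forall x y, S x y -> exists i, y = f i x) ->
  (forall X, sval v X -> sval u [set x | exists y, S x y /\ X y]) ->
  exists2 i, v = push (f i) u & sval u [set x | S x (f i x)].
Proof.
move=> Sf uv; have uU := svalP u; have vP := @ultra_proper _ _ (svalP v).
apply: contrapT => no.
have /choice [X XP] i : exists X, sval v X /\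
    ~ sval u [set x | S x (f i x) /\ X (f i x)].
  have [vE|ne] := pselect (v = push (f i) u).
    exists setT; split; first exact: filterT.
    move=> uS; apply: no; exists i => //.
    by apply: filterS uS => x [].
  apply: contrapT => /forallNP H; apply: ne; apply: Uf_eqP => X vX.
  have /not_andP [//|/contrapT uX] := H X.
  by apply: filterS uX => x [].
have vX : sval v [set x | forall i, X i x].
  by apply: filter_forall => i; apply: (XP i).1.
have [|i ui] := @ultra_cover _ _ I _
    (fun i x => S x (f i x) /\ X i (f i x)) uU (uv _ vX).
  by move=> x [y [Sxy Xy]]; have [i yE] := Sf _ _ Sxy; exists i; rewrite -yE.
exact: (XP i).2 ui.
Qed.

Lemma ue_adj_enum (G : digraph) (I : finType) (f : I -> G -> G) :
  adj_enum f -> adj_enum (G := ue G) (fun i => push (f i)).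
Proof.
move=> fP u v; have uU := svalP u; have uP := @ultra_proper _ _ uU; split=> [uv|[i ->]].
  suff [i -> _] : exists2 i, v = push (f i) u & sval u [set x | adj x (f i x)].
    by exists i.
  apply: ultra_select => [x y /fP//|X vX].
  case: uv => [uv|[uv|vu]].
  - by rewrite -uv in vX; apply: filterS vX => x Xx; exists x; split=> //; left.
  - by apply: filterS (uv _ vX) => x [y [e Xy]]; exists y; split=> //; right; left.
  - apply: filterS (ue_edge_post vu vX) => x [y [e Xy]].
    by exists y; split=> //; right; right.
(* Pointwise, [f i x] is equal to [x], a successor or a predecessor; [u] decides which case holds
   almost everywhere. *)
have fi x : adj x (f i x) by apply/fP; exists i.
have [ueq|/(ultra_setC uU) neq] := pselect (sval u [set x | id x = f i x]).
  by left; rewrite -(push_near_eq ueq) push_id.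
right; have [ue|/(ultra_setC uU) ne] := pselect (sval u [set x | edge G (id x) (f i x)]).
  by left; rewrite -{1}(push_id u); apply: ue_edge_push.
right; rewrite -{2}(push_id u); apply: ue_edge_push.
by apply: filterS2 neq ne => x /= n1 n2; have [|[]] := fi x.
Qed.

Lemma push_word (W I : Type) (f : I -> W -> W) (s : seq I) (u : Uf W) :
  word_act (fun i => push (f i)) s u = push (word_act f s) u.
Proof. by elim: s => [|i s /= ->]; rewrite ?push_id // push_comp. Qed.

(** The edge in the extension is realised by one letter [i] after [s]; [push_word_inj] then
    identifies the words [i :: s] and [t] almost everywhere, whatever their lengths. *)
Lemma push_word_edge (G : digraph) (I : finType) (f : I -> G -> G)
    (u : Uf G) (s t : seq I) : adj_enum f ->
  edge (ue G) (push (word_act f s) u) (push (word_act f t) u) ->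
  sval u [set w | edge G (word_act f s w) (word_act f t w)].
Proof.
move=> fP st; have uP := @ultra_proper _ _ (svalP u).
have [|i tE si] := @ultra_select _ _ f (edge G) _ _ _ st.
  by move=> x y e; apply/fP; right; left.
have /(push_word_inj fP) ti : push (word_act f t) u = push (word_act f (i :: s)) u.
  by rewrite tE push_comp.
have {}si : sval u [set w | edge G (word_act f s w) (f i (word_act f s w))] by [].
by apply: filterS2 si ti => w /= e ->.
Qed.

(** * Isomorphism of hulls from a common indexing *)

Lemma hull_iso_index (G H : digraph) (I : Type) (n : nat) (x : G) (y : H)
    (p : I -> G) (q : I -> H) :
  (forall z, hull_set x n z <-> exists i, z = p i) ->
  (forall z, hull_set y n z <-> exists i, z = q i) ->
  (forall i j, p i = p j <-> q i = q j) ->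
  (forall i j, edge G (p i) (p j) <-> edge H (q i) (q j)) ->
  (exists2 i, x = p i & y = q i) ->
  hull_iso G H n x y.
Proof.
move=> pP qP pq pqe [r xr yr].
have hp i : hull_set x n (p i) by apply/pP; exists i.
have hq i : hull_set y n (q i) by apply/qP; exists i.
have /choice [a aP] (z : hull n x) : exists i, sval z = p i.
  exact: (pP _).1 (svalP z).
have /choice [b bP] (z : hull n y) : exists i, sval z = q i.
  exact: (qP _).1 (svalP z).
(* The index [a z] is an arbitrary choice; [pq] makes the image independent of it. *)
exists (fun z => exist _ (q (a z)) (hq (a z))); split; last first.
  by apply: eq_exist; rewrite yr; apply/pq; rewrite -aP -xr.
split; last by move=> c d /=; rewrite !aP; apply: pqe.
exists (fun z => exist _ (p (b z)) (hp (b z))) => z.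
  case: z (aP z) (bP (exist _ (q (a z)) (hq (a z)))) => z hz /= aE bE.
  by apply: eq_exist; apply: etrans (esym aE); apply/pq.
case: z (bP z) (aP (exist _ (p (b z)) (hp (b z)))) => z hz /= bE aE.
by apply: eq_exist; apply: etrans (esym bE); apply/pq.
Qed.

Theorem theorem4p4 (F : digraph) (F_bounded : bounded_digraph F)
    (n : nat) (u : Uf F) (u_nonprincipal : nonprincipal u) :
  sval u [set w : F | hull_iso F (ue F) n w u].
Proof.
have uU := svalP u; have uP := @ultra_proper _ _ uU.
have [I [f fP]] := bounded_adj_enum F_bounded.
(* [Q] does not depend on [w]; finitely many such equivalences, one per pair of words, then hold
   simultaneously almost everywhere. *)
have decide (P : set F) (Q : Prop) : (sval u P <-> Q) -> sval u [set w | P w <-> Q].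
  move=> PQ; have [uPP|nP] := pselect (sval u P).
    by have q := PQ.1 uPP; apply: filterS uPP => w.
  have nq : ~ Q by move=> /PQ.
  by apply: filterS (ultra_setC uU nP) => w nPw; split.
have equ : sval u [set w | forall s t : n.-tuple I,
    word_act f s w = word_act f t w <->
    push (word_act f s) u = push (word_act f t) u].
  apply: filter_forall => s; apply: filter_forall => t; apply: decide.
  by split; [exact: push_near_eq|exact: push_word_inj].
have edu : sval u [set w | forall s t : n.-tuple I,
    edge F (word_act f s w) (word_act f t w) <->
    edge (ue F) (push (word_act f s) u) (push (word_act f t) u)].
  apply: filter_forall => s; apply: filter_forall => t; apply: decide.
  by split; [exact: ue_edge_push|exact: push_word_edge].
have ueP z : hull_set (G := ue F) u n z <->
    exists s : n.-tuple I, z = push (word_act f s) u.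
  rewrite (hull_set_word _ _ _ (ue_adj_enum fP)).
  by split=> -[s ->]; exists s; rewrite push_word.
(* Matching the roots requires one word [r] of length [n] that fixes [u] and also fixes almost every
   [w]; comparison with the empty word gives the latter. *)
have [r ur] := (ueP u).1 (hull_set_center (G := ue F) u n).
have wr : sval u [set w | word_act f [::] w = word_act f r w].
  by apply: push_word_inj => //; rewrite -ur push_id.
apply: filterS3 equ edu wr => w eqw edw wr.
apply: (hull_iso_index _ ueP eqw edw); last by exists r.
by move=> z; apply: hull_set_word.
Qed.
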